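(* Let $[\boldsymbol D,\boldsymbol o]$ be a unimodular discrete space. Then $$\underline{\mathrm{udim}}_M(\boldsymbol D)\le \overline{\mathrm{udim}}_M(\boldsymbol D)\le \mathrm{udim}_H(\boldsymbol D).$$
   Context: Discrete spaces. A discrete space is a metric space $(D,d)$ in which every ball of finite radius is finite. A pointed discrete space $(D,o)$ has a distinguished point $o$ (the origin); doubly-pointed ones have two. A marked (pointed) discrete space carries in addition a function $m:D\times D\to\Xi$ with $\Xi$ a complete separable metric space; $m(x):=m(x,x)$. Isomorphisms are isometries preserving origins and marks. $\mathcal D_*,\mathcal D_{**}$ (resp. $\mathcal D'_*,\mathcal D'_{**}$) are the sets of isomorphism classes of pointed and doubly-pointed discrete spaces (resp. marked ones), with classes written in brackets $[D,o]$, etc., and the Borel $\sigma$-field of the following metric: the distance is $1\wedge$ the infimum of $\epsilon>0$ such that, in both directions, there is an injection from the closed ball of radius $1/\epsilon$ around the origin of one space into the other space, preserving origins and changing distances and marks by at most $\epsilon$. A unimodular discrete space is a random element $[\boldsymbol D,\boldsymbol o]$ of $\mathcal D_*$ such that $\mathbb E[\sum_{v\in\boldsymbol D}g[\boldsymbol D,\boldsymbol o,v]]=\mathbb E[\sum_{v\in\boldsymbol D}g[\boldsymbol D,v,\boldsymbol o]]$ for all measurable $g:\mathcal D_{**}\to[0,\infty)$ (similarly in the marked case). Equivariant processes. An equivariant process with values in $\Xi$ is a map assigning to every deterministic discrete space $D$ a random element $\boldsymbol Z_D$ of $\Xi^{D\times D}$ (extra randomness allowed) such that (i) for every isometry $\rho:D_1\to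 D_2$, $\boldsymbol Z_{D_1}\circ\rho^{-1}$ has the same distribution as $\boldsymbol Z_{D_2}$; (ii) for every measurable $A\subseteq\mathcal D'_*$, $[D,o]\mapsto\mathbb P[[D,o;\boldsymbol Z_D]\in A]$ is measurable. For an equivariant process on $\boldsymbol D$ it suffices that it be defined for almost all realizations of $\boldsymbol D$; $[\boldsymbol D,\boldsymbol o;\boldsymbol Z_{\boldsymbol D}]$ is obtained by sampling $[\boldsymbol D,\boldsymbol o]$ and then the marking. An equivariant subset $\boldsymbol S$ is the set of points with mark 1 in a $\{0,1\}$-valued equivariant process; its intensity in $\boldsymbol D$ is $\mathbb P[\boldsymbol o\in\boldsymbol S_{\boldsymbol D}]$. Minkowski dimension. $N_r(v)=\{u: d(u,v)\le r\}$ for $r\geq 1$. An equivariant $r$-covering is an equivariant subset $\boldsymbol R$ such that the balls $N_r(v)$, $v\in\boldsymbol R_{\boldsymbol D}$, cover $\boldsymbol D$ a.s. Let $\lambda_r$ be the infimum of the intensities of equivariant $r$-coverings. Then $\overline{\mathrm{udim}}_M(\boldsymbol D):=\limsup_{r\to\infty}\frac{-\log\lambda_r}{\log r}$ and $\underline{\mathrm{udim}}_M(\boldsymbol D):=\liminf_{r\to\infty}\frac{-\log\lambda_r}{\log r}$. Hausdorff dimension. Put $N_0(v):=\emptyset$. An equivariant covering is an equivariant process $\boldsymbol R$ with values in $\{0\}\cup[1,\infty)$ on points such that the balls $N_{\boldsymbol R(v)}(v)$, $v\in\boldsymbol D$, cover $\boldsymbol D$ a.s. Let $\mathcal H^\alpha_1(\boldsymbol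 D):=\inf_{\boldsymbol R}\mathbb E[\boldsymbol R(\boldsymbol o)^\alpha]$ over all equivariant coverings, with $0^0:=0$. Then $\mathrm{udim}_H(\boldsymbol D):=\sup\{\alpha\ge0:\mathcal H^\alpha_1(\boldsymbol D)=0\}$, $\sup\emptyset:=0$. *)

(* Defs.v *)
From HB Require Import structures.
From mathcomp Require Import all_boot all_order all_algebra.
From mathcomp Require Import generic_quotient.
From mathcomp Require Import all_classical all_reals all_analysis.
From mathcomp Require Import measurable_realfun.
Set Implicit Arguments.
Unset Strict Implicit.
Unset Printing Implicit Defensive.
Import Order.TTheory GRing.Theory Num.Theory.
Import numFieldNormedType.Exports.
Local Open Scope classical_set_scope.
Local Open Scope ring_scope.
Local Open Scope quotient_scope.

(* The carrier is not a [metricType R]: the isomorphism classes below have to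
   form a [choiceType], and the universe of [metricType] is too large for that.
   As a discrete space is countable, the universe of the carrier is immaterial. *)
Record discreteSpace (R : realType) := DiscreteSpace {
  carrier :> Type;
  dist : carrier -> carrier -> R;
  dist_eq0 : forall x y, dist x y = 0 <-> x = y;
  dist_sym : forall x y, dist x y = dist y x;
  dist_triangle : forall x y z, dist x z <= dist x y + dist y z;
  finite_balls : forall x r, finite_set [set y | dist x y <= r]
}.
Arguments dist {R d}.

HB.instance Definition _ R (D : discreteSpace R) := gen_eqMixin (carrier D).
HB.instance Definition _ R (D : discreteSpace R) := gen_choiceMixin (carrier D).

(* Completeness and separability are not part of the structure: the marks used
   below range over closed subsets of the reals and over one point. *)
#[short(type="markType")]
HB.structure Definition MarkSpace (R : numDomainType) :=
  {T of Metric R T & Pointed T}.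

(* An unmarked space is a space with marks in a one-point space. *)
Definition nomark (R : realType) : Type := unit.

Section nomark.
Variable R : realType.
HB.instance Definition _ := Pointed.copy (nomark R) unit.
Let nomark_dist (x y : nomark R) : R := 0.
Let nomark0 x : nomark_dist x x = 0. Proof. by []. Qed.
Let nomark_eq x y : nomark_dist x y = 0 -> x = y.
Proof. by case: x; case: y. Qed.
Let nomark_sym x y : nomark_dist x y = nomark_dist y x. Proof. by []. Qed.
Let nomark_triangle y x z :
  nomark_dist x z <= nomark_dist x y + nomark_dist y z.
Proof. by rewrite /nomark_dist addr0. Qed.
HB.instance Definition _ := isMetric.Build R (nomark R)
  nomark0 nomark_eq nomark_sym nomark_triangle.
End nomark.

Definition mark01 (R : realType) : Type := bool.

Section mark01.
Variable R : realType.
HB.instance Definition _ := Pointed.copy (mark01 R) bool.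
Let mark01_dist (x y : mark01 R) : R := `|(x : bool)%:R - (y : bool)%:R|.
Let mark01_0 x : mark01_dist x x = 0. Proof. by rewrite /mark01_dist subrr normr0. Qed.
Let mark01_eq x y : mark01_dist x y = 0 -> x = y.
Proof.
move=> /normr0_eq0/eqP; rewrite subr_eq0.
by case: x; case: y => //=; rewrite ?(eq_sym 0) oner_eq0.
Qed.
Let mark01_sym x y : mark01_dist x y = mark01_dist y x.
Proof. exact: distrC. Qed.
Let mark01_triangle y x z : mark01_dist x z <= mark01_dist x y + mark01_dist y z.
Proof. exact: ler_distD. Qed.
HB.instance Definition _ := isMetric.Build R (mark01 R)
  mark01_0 mark01_eq mark01_sym mark01_triangle.
End mark01.

Definition radius_mark (R : realType) : Type := {x : R | (x == 0) || (1 <= x)}.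

Section radius_mark.
Variable R : realType.
HB.instance Definition _ := Choice.copy (radius_mark R) {x : R | (x == 0) || (1 <= x)}.
Let radius00 : ((0 : R) == 0) || (1 <= (0 : R)). Proof. by rewrite eqxx. Qed.
HB.instance Definition _ :=
  isPointed.Build (radius_mark R) (exist _ 0 radius00 : {x : R | _}).
Let radius_dist (x y : radius_mark R) : R := `|sval x - sval y|.
Let radius0 x : radius_dist x x = 0.
Proof. by rewrite /radius_dist subrr normr0. Qed.
Let radius_eq x y : radius_dist x y = 0 -> x = y.
Proof. by move=> /normr0_eq0/eqP; rewrite subr_eq0 => /eqP/val_inj. Qed.
Let radius_sym x y : radius_dist x y = radius_dist y x.
Proof. exact: distrC. Qed.
Let radius_triangle y x z :
  radius_dist x z <= radius_dist x y + radius_dist y z.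
Proof. exact: ler_distD. Qed.
HB.instance Definition _ := isMetric.Build R (radius_mark R)
  radius0 radius_eq radius_sym radius_triangle.
End radius_mark.

(* [k.+1] distinguished points: [k = 0] for pointed spaces, [k = 1] for
   doubly-pointed ones. *)
Record rooted (R : realType) (k : nat) (Xi : markType R) := Rooted {
  space : discreteSpace R;
  roots : k.+1.-tuple space;
  mark : space -> space -> Xi
}.
Arguments Rooted {R k Xi} space roots mark.

HB.instance Definition _ R k Xi := gen_eqMixin (@rooted R k Xi).
HB.instance Definition _ R k Xi := gen_choiceMixin (@rooted R k Xi).

Section rooted.
Context {R : realType} {k : nat} {Xi : markType R}.
Implicit Types X Y : rooted k Xi.

Definition origin X : space X := thead (roots X).

Definition iso X Y := exists f : space X -> space Y,
  [/\ bijective f,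
      (forall x y, dist (f x) (f y) = dist x y),
      map_tuple f (roots X) = roots Y &
      (forall x y, mark (f x) (f y) = mark x y)].

(* The injection of the closed ball of radius [e^-1] is given by a function [f]
   on the whole space, whose values outside the ball and the roots are
   irrelevant. *)
Definition ball_embedding (e : R) X Y := exists f : space X -> space Y,
  let B := [set x | dist (origin X) x <= e^-1] in
  [/\ map_tuple f (roots X) = roots Y,
      {in B &, injective f},
      (forall x y, B x -> B y -> `|dist (f x) (f y) - dist x y| <= e) &
      (forall x y, B x -> B y -> mdist (mark (f x) (f y)) (mark x y) <= e)].

(* [1] belongs to the set, so that this is the minimum of [1] and of an infimum
   which is [+oo] for the empty set. *)
Definition rooted_dist X Y : R :=
  inf (1 |` [set e | [/\ 0 < e, ball_embedding e X Y & ball_embedding e Y X]]).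

Definition iso_rel : rel (rooted k Xi) := fun X Y => `[< iso X Y >].

Lemma iso_rel_refl : reflexive iso_rel.
Proof.
move=> X; apply/asboolP; exists id; split=> //; first by exists id.
by apply: val_inj; rewrite /= map_id.
Qed.

Lemma iso_rel_sym : symmetric iso_rel.
Proof.
suff h X Y : iso X Y -> iso Y X.
  by move=> X Y; apply/asboolP/asboolP; exact: h.
move=> [f [[g fK gK] df rf mf]]; exists g; split.
- by exists f.
- by move=> x y; rewrite -df !gK.
- by rewrite -rf; apply: val_inj; rewrite /= -map_comp map_id_in// => x _ /=.
- by move=> x y; rewrite -mf !gK.
Qed.

Lemma iso_rel_trans : transitive iso_rel.
Proof.
move=> Y X Z /asboolP[f [bf df rf mf]] /asboolP[g [bg dg rg mg]].
apply/asboolP; exists (g \o f); split.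
- exact: bij_comp.
- by move=> x y /=; rewrite dg df.
- by rewrite -rg -rf; apply: val_inj; rewrite /= -map_comp.
- by move=> x y /=; rewrite mg mf.
Qed.

Canonical iso_equiv :=
  EquivRel iso_rel iso_rel_refl iso_rel_sym iso_rel_trans.
End rooted.

Definition iclass (R : realType) (k : nat) (Xi : markType R) : Type :=
  {eq_quot (@iso_equiv R k Xi)}.

Section one_point.
Variable R : realType.
Let d (_ _ : unit) : R := 0.
Let d0 x y : d x y = 0 <-> x = y. Proof. by case: x; case: y. Qed.
Let d_sym x y : d x y = d y x. Proof. by []. Qed.
Let d_triangle x y z : d x z <= d x y + d y z.
Proof. by rewrite /d addr0. Qed.
Let d_finite (x : unit) (r : R) : finite_set [set y | d x y <= r].
Proof. exact: finite_finset. Qed.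
Definition one_point : discreteSpace R :=
  DiscreteSpace d0 d_sym d_triangle d_finite.
End one_point.

Section iclass.
Context {R : realType} {k : nat} {Xi : markType R}.
Local Notation iclass := (@iclass R k Xi).

HB.instance Definition _ := Choice.on iclass.
HB.instance Definition _ := EqQuotient.on iclass.
HB.instance Definition _ := isPointed.Build iclass
  (\pi_iclass (Rooted (one_point R) (nseq_tuple k.+1 tt) (fun _ _ => point))).

Definition iclass_dist (a b : iclass) : R := rooted_dist (repr a) (repr b).

Definition iclass_open : set (set iclass) := [set U | forall a, U a ->
  exists2 e : R, 0 < e & forall b, iclass_dist a b < e -> U b].

HB.instance Definition _ :=
  Measurable.copy iclass (g_sigma_algebraType iclass_open).
End iclass.

Section brackets.
Context {R : realType}.

Definition Dstar := iclass 0 (nomark R).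
Definition Dstarstar := iclass 1 (nomark R).
Definition Dstar' (Xi : markType R) := iclass 0 Xi.

(* [D, o, v] *)
Definition class2 (D : discreteSpace R) (o v : D) : Dstarstar :=
  \pi_(iclass 1 (nomark R)) (Rooted D [tuple o; v] (fun _ _ => tt : nomark R)).

(* [D, o; m] *)
Definition mclass (Xi : markType R) (D : discreteSpace R) (o : D)
  (m : D -> D -> Xi) : Dstar' Xi :=
  \pi_(iclass 0 Xi) (Rooted D [tuple o] m).

(* A representative (D, o) of [a]; [D_ a] and [o_ a] are only used in
   expressions that are invariant under isomorphism. *)
Definition D_ (a : Dstar) : discreteSpace R := space (repr a).
Definition o_ (a : Dstar) : D_ a := origin (repr a).
End brackets.
Arguments Dstar : clear implicits.
Arguments Dstarstar : clear implicits.

Local Open Scope ereal_scope.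

Definition unimodular (R : realType) d (Omega : measurableType d)
    (P : probability Omega R) (X : {RV P >-> Dstar R}) :=
  forall g : Dstarstar R -> R, measurable_fun [set: Dstarstar R] g ->
    (forall a, (0 <= g a)%R) ->
  \int[P]_w (\esum_(v in [set: D_ (X w)]) (g (class2 (o_ (X w)) v))%:E) =
  \int[P]_w (\esum_(v in [set: D_ (X w)]) (g (class2 v (o_ (X w))))%:E).

Definition marking (R : realType) (D : discreteSpace R) (Xi : markType R) :
  Type := D -> D -> Xi.

Section marking.
Context {R : realType} (D : discreteSpace R) (Xi : markType R).
HB.instance Definition _ := Pointed.copy (marking D Xi) (D -> D -> Xi).

Definition marking_cylinder : set (set (marking D Xi)) :=
  [set A | exists x y (U : set Xi), open U /\ A = [set m | U (m x y)]].

HB.instance Definition _ :=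
  Measurable.copy (marking D Xi) (g_sigma_algebraType marking_cylinder).
End marking.

(* Defined on every discrete space: a process given on almost all realizations
   of a random space is extended by a constant marking on the others. *)
Record equivariantProcess (R : realType) (Xi : markType R) := {
  ep_display : discreteSpace R -> measure_display;
  ep_Omega : forall D, measurableType (ep_display D);
  ep_P : forall D, probability (ep_Omega D) R;
  ep_Z :> forall D, {RV (ep_P D) >-> marking D Xi};
  ep_equivariant : forall (D1 D2 : discreteSpace R)
      (rho : D1 -> D2) (rho' : D2 -> D1),
    cancel rho rho' -> cancel rho' rho ->
    (forall x y, dist (rho x) (rho y) = dist x y) ->
    forall A : set (marking D2 Xi), measurable A ->
    ep_P D1 [set t | A (fun x y => ep_Z D1 t (rho' x) (rho' y))] =
    ep_P D2 [set t | A (ep_Z D2 t)];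
  ep_measurable : forall A : set (Dstar' Xi), measurable A ->
    measurable_fun [set: Dstar R] ((fun a =>
      ep_P (D_ a) [set t | A (mclass (o_ a) (ep_Z (D_ a) t))]) : _ -> \bar R)
}.

Definition N_ (R : realType) (D : discreteSpace R) (r : R) (v : D) : set D :=
  if r == 0%R then set0 else [set u | (dist u v <= r)%R].

(* [0 `^ 0 = 1] in the library, while the convention here is 0^0 = 0. *)
Definition powR0 (R : realType) (x a : R) : R :=
  (if x == 0 then 0 else x `^ a)%R.

Section dimensions.
Context {R : realType} d (Omega : measurableType d) (P : probability Omega R).
Variable X : {RV P >-> Dstar R}.

Definition intensity (S : equivariantProcess (mark01 R)) : \bar R :=
  \int[P]_w ep_P S (D_ (X w)) [set t | S _ t (o_ (X w)) (o_ (X w)) = true].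

Definition r_covering (r : R) (S : equivariantProcess (mark01 R)) : Prop :=
  \forall w \ae P, \forall t \ae ep_P S (D_ (X w)),
    \bigcup_(v in [set v | S _ t v v = true]) N_ r v = [set: D_ (X w)].

Definition lambda_ (r : R) : \bar R :=
  ereal_inf [set x | exists2 S, r_covering r S & x = intensity S].

Definition udimM_upper : \bar R :=
  limf_esup (fun r : R => - lne (lambda_ r) / (ln r)%:E) (pinfty_nbhs R).

Definition udimM_lower : \bar R :=
  limf_einf (fun r : R => - lne (lambda_ r) / (ln r)%:E) (pinfty_nbhs R).

Definition covering (S : equivariantProcess (radius_mark R)) : Prop :=
  \forall w \ae P, \forall t \ae ep_P S (D_ (X w)),
    \bigcup_v N_ (sval (S _ t v v)) v = [set: D_ (X w)].

Definition radius_moment (a : R) (S : equivariantProcess (radius_mark R)) : \bar R :=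
  \int[P]_w \int[ep_P S (D_ (X w))]_t
    (powR0 (sval (S _ t (o_ (X w)) (o_ (X w)))) a)%:E.

Definition H1 (a : R) : \bar R :=
  ereal_inf [set x | exists2 S, covering S & x = radius_moment a S].

(* The maximum with [0] only accounts for the convention sup set0 = 0. *)
Definition udimH : \bar R :=
  maxe 0 (ereal_sup [set a%:E | a in [set a | (0 <= a)%R /\ H1 a = 0]]).
End dimensions.

(* Main.v *)
(* An equivariant r-covering S becomes an equivariant covering by giving radius
   r to the points of S and radius 0 to the others, and the a-th moment of the
   radius is then r^a times the intensity of S. If a < b < udimM_upper, there
   are arbitrarily large r with an r-covering of intensity below r^(-b), so H1 a
   is at most r^(a - b), hence 0. Replacing marks by a uniformly continuous
   function of the marks is continuous on isomorphism classes, so that the new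
   process is again an equivariant process. *)
Require Import Defs.
From HB Require Import structures.
From mathcomp Require Import all_boot all_order all_algebra.
From mathcomp Require Import generic_quotient.
From mathcomp Require Import all_classical all_reals all_analysis.
From mathcomp Require Import measurable_realfun.
Set Implicit Arguments.
Unset Strict Implicit.
Unset Printing Implicit Defensive.
Import Order.TTheory GRing.Theory Num.Theory.
Import numFieldNormedType.Exports.
(* [all_algebra] hides [Defs.space] behind the [space] of [vector]. *)
Import Defs.
Local Open Scope classical_set_scope.
Local Open Scope ring_scope.
Local Open Scope quotient_scope.

(** * Isomorphism invariance and the distance between classes *)

Section isomorphism_classes.
Context {R : realType} {k : nat} {Xi : markType R}.
Implicit Types X Y : rooted k Xi.

Lemma iso_sym X Y : iso X Y -> iso Y X.
Proof.
move=> h; apply/asboolP; rewrite -/(iso_rel Y X) iso_rel_sym.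
exact/asboolP.
Qed.

Lemma eq_iclassP X Y : \pi_(iclass k Xi) X = \pi_(iclass k Xi) Y <-> iso X Y.
Proof.
split=> [/(eqmodP (@iso_equiv R k Xi))/asboolP //|h].
by apply/(eqmodP (@iso_equiv R k Xi))/asboolP.
Qed.

Lemma iso_repr X : iso (repr (\pi_(iclass k Xi) X)) X.
Proof. by apply/eq_iclassP; rewrite reprK. Qed.

Lemma map_origin X Y (f : space X -> space Y) :
  map_tuple f (roots X) = roots Y -> f (origin X) = origin Y.
Proof. by move=> rf; rewrite /origin /thead -rf tnth_map. Qed.

Lemma iso_origin_mark X Y : iso X Y ->
  mark (origin Y) (origin Y) = mark (origin X) (origin X).
Proof. by move=> [f [_ _ /map_origin <- ->]]. Qed.

(** Conjugation by the two isomorphisms. [iclass_dist] compares chosen representatives, so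
    embeddings have to be moved to and from them. *)
Lemma ball_embedding_iso e X X' Y Y' : iso X X' -> iso Y Y' ->
  ball_embedding e X Y -> ball_embedding e X' Y'.
Proof.
move=> /iso_sym[g [bg dg rg mg]] [h [bh dh rh mh]] [f [rf fI df mf]].
have gB x : dist (origin X') x <= e^-1 -> dist (origin X) (g x) <= e^-1.
  by rewrite -(map_origin rg) dg.
exists (h \o f \o g); split.
- by rewrite -rh -rf -rg; apply: val_inj; rewrite /= -!map_comp.
- move=> x y /set_mem/gB xB /set_mem/gB yB /= /(bij_inj bh)/fI gxy.
  by apply/(bij_inj bg)/gxy; exact/mem_set.
- by move=> x y /gB xB /gB yB /=; rewrite dh -dg; exact: df.
- by move=> x y /gB xB /gB yB /=; rewrite mh -mg; exact: mf.
Qed.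

(** The bound [e <= 1] rules out the element [1] adjoined to the set in [rooted_dist], so that a
    genuine pair of embeddings undercuts [e]. *)
Lemma rooted_dist_lt X Y (e : R) : e <= 1 -> rooted_dist X Y < e ->
  exists c, [/\ 0 < c, c < e, ball_embedding c X Y & ball_embedding c Y X].
Proof.
move=> e1 /inf_lt[|c [->|[c0 cXY cYX]] ce]; first by exists 1; left.
- by move: ce; rewrite ltNge e1.
- by exists c.
Qed.

Lemma rooted_dist_le X Y (e : R) : 0 < e ->
  ball_embedding e X Y -> ball_embedding e Y X -> rooted_dist X Y <= e.
Proof.
move=> e0 XY YX; apply: ge_inf; last by right.
by exists 0 => x [->|[/ltW]]; rewrite ?ler01.
Qed.

End isomorphism_classes.

(** * Changing marks by a uniformly continuous function *)

Section map_marks.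
Context {R : realType} {k : nat} {Xi1 Xi2 : markType R} (phi : Xi1 -> Xi2).

Definition map_marks (X : rooted k Xi1) : rooted k Xi2 :=
  Rooted (space X) (roots X) (fun x y => phi (mark x y)).

Definition map_iclass (a : iclass k Xi1) : iclass k Xi2 :=
  \pi_(iclass k Xi2) (map_marks (repr a)).

Lemma iso_map_marks X Y : iso X Y -> iso (map_marks X) (map_marks Y).
Proof. by move=> [f [bf df rf mf]]; exists f; split=> //= x y; rewrite mf. Qed.

Lemma map_iclass_pi X :
  map_iclass (\pi_(iclass k Xi1) X) = \pi_(iclass k Xi2) (map_marks X).
Proof. exact/eq_iclassP/iso_map_marks/iso_repr. Qed.

Hypothesis phi_unif : forall e : R, 0 < e ->
  exists2 c : R, 0 < c &
    forall u v, mdist u v <= c -> mdist (phi u) (phi v) <= e.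

Lemma ball_embedding_map_marks (e : R) : 0 < e -> exists2 c0 : R, 0 < c0 &
  forall c X Y, 0 < c -> c <= c0 ->
    ball_embedding c X Y -> ball_embedding e (map_marks X) (map_marks Y).
Proof.
move=> e0; have [c1 c10 phiP] := phi_unif e0.
(* With [c <= e] the ball of radius [c^-1] contains that of radius [e^-1]; [c <= c1] controls the
   marks. *)
exists (Num.min e c1); first by rewrite lt_min e0.
move=> c X Y c0; rewrite le_min => /andP[ce cc1] [f [rf fI df mf]].
have Bsub (x : space X) :
    dist (origin X) x <= e^-1 -> dist (origin X) x <= c^-1.
  by move=> /le_trans; apply; rewrite lef_pV2.
exists f; split => //=.
- by move=> x y /set_mem/Bsub xB /set_mem/Bsub yB; apply: fI; exact/mem_set.
- by move=> x y /Bsub xB /Bsub yB; apply: le_trans (df _ _ xB yB) ce.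
- by move=> x y /Bsub xB /Bsub yB; apply/phiP/(le_trans (mf _ _ xB yB) cc1).
Qed.

Lemma iclass_open_map_iclass (U : set (iclass k Xi2)) :
  iclass_open U -> iclass_open (map_iclass @^-1` U).
Proof.
move=> Uo a /= /Uo[e e0 eU].
(* Embeddings bound the distance only weakly; taking [e / 2] gives a distance strictly below [e]. *)
have [c0 c00 cP] := ball_embedding_map_marks (divr_gt0 e0 (ltr0n _ 2)).
(* The cap at [1] meets the condition of [rooted_dist_lt]. *)
exists (Num.min c0 1); first by rewrite lt_min c00 ltr01.
move=> b /rooted_dist_lt[|c [c_gt0 + cab cba]].
  by rewrite ge_min lexx orbT.
rewrite lt_min => /andP[/ltW cc0 _]; apply: eU.
rewrite /iclass_dist (@le_lt_trans _ _ (e / 2))//; last first.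
  by rewrite ltr_pdivrMr// ltr_pMr// ltr1n.
have isoP (X : rooted k Xi1) :
    iso (map_marks X) (repr (\pi_(iclass k Xi2) (map_marks X))).
  exact/iso_sym/iso_repr.
apply: rooted_dist_le; first by rewrite divr_gt0.
- exact: ball_embedding_iso (isoP _) (isoP _) (cP _ _ _ c_gt0 cc0 cab).
- exact: ball_embedding_iso (isoP _) (isoP _) (cP _ _ _ c_gt0 cc0 cba).
Qed.

Lemma measurable_map_iclass : measurable_fun [set: iclass k Xi1] map_iclass.
Proof.
apply: (measurability iclass_open) => // _ [U Uo <-].
by rewrite setTI; apply: sub_sigma_algebra; exact: iclass_open_map_iclass.
Qed.

Lemma measurable_map_marking (D : discreteSpace R) :
  measurable_fun [set: marking D Xi1]
    ((fun m x y => phi (m x y)) : marking D Xi1 -> marking D Xi2).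
Proof.
apply: (measurability (@marking_cylinder R D Xi2)) => //.
move=> _ [_ [x [y [U [oU ->]]]] <-]; rewrite setTI; apply: sub_sigma_algebra.
(* The preimage of a cylinder is a cylinder at the same pair of points, and its base is open by
   continuity of [phi]. *)
exists x, y, (phi @^-1` U); split=> //.
apply: open_comp oU => u _; apply/metricType_numDomainType.cvgrPdist_le => e e0.
have [c c0 phiP] := phi_unif e0.
apply/metricType_numDomainType.nbhs_mdistP.
by exists c => // v /= /ltW /phiP.
Qed.

End map_marks.

(** * Equivariant processes under a change of marks *)

Section map_process.
Context {R : realType} {Xi1 Xi2 : markType R} (phi : Xi1 -> Xi2).
Hypothesis phi_unif : forall e : R, 0 < e ->
  exists2 c : R, 0 < c &
    forall u v, mdist u v <= c -> mdist (phi u) (phi v) <= e.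
Variable S : equivariantProcess Xi1.

Let Z (D : discreteSpace R) (t : ep_Omega S D) : marking D Xi2 :=
  fun x y => phi (S D t x y).

Let mZ D : measurable_fun [set: ep_Omega S D] (@Z D).
Proof.
exact (measurableT_comp (measurable_map_marking phi_unif (D:=D))
  (measurable_funPT (ep_Z S D))).
Qed.

HB.instance Definition _ D := isMeasurableFun.Build _ _ _ _ (@Z D) (@mZ D).

Let RV D : {RV ep_P S D >-> marking D Xi2} := @Z D.

Lemma map_process_equivariant (D1 D2 : discreteSpace R)
      (rho : D1 -> D2) (rho' : D2 -> D1) :
    cancel rho rho' -> cancel rho' rho ->
    (forall x y, dist (rho x) (rho y) = dist x y) ->
    forall A : set (marking D2 Xi2), measurable A ->
    ep_P S D1 [set t | A (fun x y => RV D1 t (rho' x) (rho' y))] =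
    ep_P S D2 [set t | A (RV D2 t)].
Proof.
move=> K K' drho A mA.
apply: (@ep_equivariant _ _ S _ _ _ _ K K' drho
  [set m | A (fun x y => phi (m x y))]).
rewrite -[X in measurable X]setTI.
exact: (measurable_map_marking phi_unif measurableT mA).
Qed.

(** The event for [A] is the event of [S] for the preimage of [A] under [map_iclass]. *)
Lemma map_process_measurable (A : set (Dstar' Xi2)) : measurable A ->
    measurable_fun [set: Dstar R] ((fun a =>
      ep_P S (D_ a) [set t | A (mclass (o_ a) (RV (D_ a) t))]) : _ -> \bar R).
Proof.
move=> mA.
have mphiA : measurable (map_iclass phi @^-1` A : set (Dstar' Xi1)).
  by rewrite -[X in measurable X]setTI; exact: measurable_map_iclass.
have := ep_measurable S mphiA.
congr (measurable_fun _ _); apply/funext => a; congr (ep_P S _ _).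
by apply/seteqP; split => t /=; rewrite map_iclass_pi.
Qed.

Definition map_process : equivariantProcess Xi2 :=
  {| ep_Z := RV; ep_equivariant := map_process_equivariant;
     ep_measurable := map_process_measurable |}.

End map_process.

(** * Limits superior and logarithms in the extended reals *)

Lemma limf_einf_le_esup (T : choiceType) (V : filteredType T) (R : realType)
    (f : V -> \bar R) (F : set_system V) :
  ProperFilter F -> (limf_einf f F <= limf_esup f F)%E.
Proof.
move=> FF; rewrite limf_einfE limf_esupE.
apply/ereal_supP => _ [A FA <-]; apply/ereal_infP => _ [B FB <-].
(* Two members of a proper filter meet; the value at a common point lies between the infimum over
   one and the supremum over the other. *)
have [x [Ax Bx]] := filter_ex (filterI FA FB).
apply: (@le_trans _ _ (f x)).
- by apply: ereal_inf_lbound; exists x.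
- by apply: ereal_sup_ubound; exists x.
Qed.

Lemma limf_esup_gt_frequently (R : realType) (f : R -> \bar R) (b : \bar R)
    (M : R) :
  (b < limf_esup f (pinfty_nbhs R))%E -> exists2 r : R, M < r & (b < f r)%E.
Proof.
rewrite limf_esupE => bf.
(* The limit superior is an infimum over members of the filter, and the half-line beyond [M] is one
   of them. *)
have : (b < ereal_sup (f @` [set r | (M < r)%R]))%E.
  apply: (lt_le_trans bf); apply: ereal_inf_lbound.
  exists [set r | (M < r)%R] => //.
  by exists M; split=> //; exact: num_real.
by move=> /ereal_sup_gt[_ [r Mr <-]]; exists r.
Qed.

(** Multiply by [ln r], which is positive, and exponentiate; [lne] and [expeR] are inverse on all of
    [[0, +oo]], which covers [x = 0]. *)
Lemma lt_powR_of_lt_log (R : realType) (x : \bar R) (b r : R) :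
  (0 <= x)%E -> 1 < r -> (b%:E < - lne x / (ln r)%:E)%E ->
  (x < (r `^ (- b))%:E)%E.
Proof.
move=> x0 r1; have lnr : 0 < ln r by rewrite ln_gt0.
have r0 : 0 < r by rewrite (lt_trans ltr01).
rewrite inver gt_eqF// lte_pdivlMr// -EFinM lteNr => lx.
rewrite -[x]lneK ?in_itv/= ?x0 ?leey//.
have -> : (r `^ (- b))%:E = expeR (- (b * ln r)%:E) :> \bar R.
  by rewrite /powR gt_eqF//= mulNr.
by rewrite lte_expeR.
Qed.

Lemma lte_EFin_between (R : realType) (a : R) (y : \bar R) :
  (a%:E < y)%E -> exists2 b : R, a < b & (b%:E < y)%E.
Proof.
case: y => [y| |//].
- by rewrite lte_fin => ay; exists ((a + y) / 2); rewrite ?lte_fin midf_lt.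
- by move=> _; exists (a + 1); rewrite ?ltrDl ?ltry.
Qed.

(** * The radius attached to a selection mark *)

Section ball_radius.
Context {R : realType} (r : R) (r1 : 1 <= r).

Let radius (b : bool) : R := if b then r else 0.

Lemma radius_eq0_or_ge1 b : (radius b == 0) || (1 <= radius b).
Proof. by case: b; rewrite ?eqxx // [radius _]/= r1 orbT. Qed.

Definition ball_radius (b : mark01 R) : radius_mark R :=
  exist _ (radius b) (radius_eq0_or_ge1 b).

Lemma mark01_lt1 (u v : mark01 R) : mdist u v < 1 -> u = v.
Proof.
by case: u v => [] [] //; rewrite /mdist/= ?subr0 ?sub0r ?normrN normr1 ltxx.
Qed.

Lemma ball_radius_unif (e : R) : 0 < e -> exists2 c : R, 0 < c &
  forall u v, mdist u v <= c -> mdist (ball_radius u) (ball_radius v) <= e.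
Proof.
(* Distinct selection marks are at distance 1, so any constant below 1 forces equality. *)
move=> e0; exists 2^-1; first by rewrite invr_gt0.
move=> u v uv; have -> : u = v.
  by apply: mark01_lt1; apply: le_lt_trans uv _; rewrite invf_lt1 ?ltr1n.
by rewrite mdistxx ltW.
Qed.

End ball_radius.

(** * From r-coverings to coverings *)

Section from_r_covering.
Local Open Scope ereal_scope.
Context {R : realType} d (Omega : measurableType d) (P : probability Omega R).
Variable X : {RV P >-> Dstar R}.
Variables (r : R) (r1 : (1 <= r)%R) (S : equivariantProcess (mark01 R)).

Let T := map_process (ball_radius_unif r1) S.

Lemma covering_of_r_covering : r_covering X r S -> covering X T.
Proof.
apply: filterS => w; apply: filterS => t /seteqP[_ cov].
apply/seteqP; split=> // x /cov[v /= vS xv]; exists v => //=.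
by rewrite vS.
Qed.

(** Selection of the origin is an open property of the class, since an embedding with tolerance
    below 1 preserves the mark of the origin. This measurability lets the factor r^a leave the
    integral over [P]. *)
Lemma measurable_origin_selected : measurable_fun [set: Omega]
  (fun w => ep_P S (D_ (X w)) [set t | S _ t (o_ (X w)) (o_ (X w)) = true]).
Proof.
pose A := [set a : Dstar' (mark01 R) |
    mark (origin (repr a)) (origin (repr a)) = true].
have oA : iclass_open A.
  move=> a Aa; exists 1%R => // b.
  move=> /rooted_dist_lt[//|c [c0 c1 [f [rf _ _ mf]] _]].
  have oB : (dist (origin (repr a)) (origin (repr a)) <= c^-1)%R.
    by rewrite (dist_eq0 _ _).2// invr_ge0 ltW.
  have := mf _ _ oB oB; rewrite (map_origin rf) => /le_lt_trans/(_ c1).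
  by move=> /mark01_lt1; rewrite /A /= => ->.
have mA : measurable A by exact: sub_sigma_algebra.
have := measurableT_comp (ep_measurable S mA) (measurable_funPT X).
congr (measurable_fun _ _); apply/funext => w /=; congr (ep_P S _ _).
apply/seteqP; split => t; rewrite /A /= /mclass.
- by rewrite -(iso_origin_mark (iso_repr _)).
- by rewrite -(iso_origin_mark (iso_repr _)).
Qed.

Lemma radius_moment_ball_radius (a : R) :
  radius_moment X a T = (r `^ a)%:E * intensity X S.
Proof.
have r0 : (0 < r)%R by rewrite (lt_le_trans ltr01).
rewrite /radius_moment /intensity -ge0_integralZl//; last 2 first.
- exact: measurable_origin_selected.
- by rewrite lee_fin powR_ge0.
apply: eq_integral => w _.
pose B := [set t | S (D_ (X w)) t (o_ (X w)) (o_ (X w)) = true].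
have mB : measurable B.
  rewrite -[B]setTI.
  apply: (measurable_funPT (ep_Z S _) measurableT
    [set m | m (o_ (X w)) (o_ (X w)) = true]).
  (* The mark [true] is isolated, so selection of the origin is a cylinder event. *)
  apply: sub_sigma_algebra; exists (o_ (X w)), (o_ (X w)), [set true].
  split=> //; rewrite openE => u ->.
  apply/(metricType_numDomainType.nbhs_mdistP (true : mark01 R)).
  by exists 1%R => //= v /mark01_lt1 <-.
rewrite -/B -[X in ep_P _ _ X]setIT -integral_indic// -ge0_integralZl//.
(* The radius is [r] on [B] and 0 off it; the convention 0^0 = 0 makes the second case vanish also
   for [a = 0]. *)
- apply: eq_integral => t _; rewrite indicE /powR0.
  have [tB|/[dup] ntB /negP/negbTE tF] := pselect (B t).
    by rewrite mem_set// mule1 /= [S _ t _ _]tB gt_eqF.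
  by rewrite memNset// mule0 /= [S _ t _ _]tF eqxx.
- exact/measurable_EFinP/measurable_indic.
- by rewrite lee_fin powR_ge0.
Qed.

End from_r_covering.

(** * Comparison of the dimensions *)

Section dimension_bound.
Local Open Scope ereal_scope.
Context {R : realType} d (Omega : measurableType d) (P : probability Omega R).
Variable X : {RV P >-> Dstar R}.

Lemma H1_ge0 (a : R) : 0 <= H1 X a.
Proof.
apply/ereal_infP => _ [S _ ->]; apply: integral_ge0 => w _.
apply: integral_ge0 => t _; rewrite lee_fin /powR0.
by case: ifP => // _; exact: powR_ge0.
Qed.

Lemma lambda_ge0 (r : R) : 0 <= lambda_ X r.
Proof.
by apply/ereal_infP => _ [S _ ->]; apply: integral_ge0.
Qed.

Lemma H1_eq0 (a : R) : a%:E < udimM_upper X -> H1 X a = 0.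
Proof.
move=> aX; apply/eqP; rewrite eq_le H1_ge0 andbT.
have [b ab bX] := lte_EFin_between aX.
apply/lee_addgt0Pr => e e0; rewrite add0e.
have ba0 : (0 < b - a)%R by rewrite subr_gt0.
(* Beyond the second threshold r^(b - a) exceeds 1/e, so r^(a - b) < e; the threshold 1 keeps [ln r]
   positive and makes [r] an admissible radius. *)
have [r Mr br] := limf_esup_gt_frequently
  (Num.max 1 (e^-1 `^ (b - a)^-1))%R bX.
move: Mr; rewrite gt_max => /andP[r1 er].
have r0 : (0 < r)%R by rewrite (lt_trans ltr01).
have /ereal_inf_lt[_ [S cS ->] Sr] := lt_powR_of_lt_log (lambda_ge0 r) r1 br.
pose T := map_process (ball_radius_unif (ltW r1)) S.
apply: (@le_trans _ _ (radius_moment X a T)).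
  by apply: ereal_inf_lbound; exists T => //; exact: covering_of_r_covering.
rewrite radius_moment_ball_radius.
apply: (@le_trans _ _ ((r `^ a)%:E * (r `^ (- b))%:E)).
  by rewrite lee_pmul2l// ?ltW// lte_fin powR_gt0.
rewrite -EFinM lee_fin -powRD ?(gt_eqF r0) ?implybT//.
(* Inverting both sides leaves 1/e <= r^(b - a), which follows from monotonicity of the power with
   exponent [b - a > 0]. *)
rewrite -opprB powRN -[leRHS]invrK lef_pV2 ?posrE ?invr_gt0 ?powR_gt0//.
have -> : (e^-1 = (e^-1 `^ (b - a)^-1) `^ (b - a))%R.
  by rewrite -powRrM mulVf ?gt_eqF// powRr1// invr_ge0 ltW.
by rewrite ge0_ler_powR ?nnegrE ?powR_ge0// ltW.
Qed.

(** Otherwise a real [b] strictly between the two dimensions has [H1 X b = 0], which forces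
    [b <= udimH X]. *)
Lemma udimM_upper_le_udimH : udimM_upper X <= udimH X.
Proof.
rewrite leNgt; apply/negP => HM.
(* This serves twice: for the finiteness of [udimH X], and for [0 <= b], which the supremum demands
   of its exponents. *)
have H0 : 0 <= udimH X by rewrite le_max lexx.
have Hfin : udimH X \is a fin_num.
  by rewrite ge0_fin_numE// (lt_le_trans HM) ?leey.
move: HM; rewrite -(fineK Hfin) => /lte_EFin_between[b Hb bX].
have : b%:E <= udimH X.
  rewrite le_max; apply/orP; right; apply: ereal_sup_ubound; exists b => //.
  split; last exact: H1_eq0.
  by rewrite (le_trans _ (ltW Hb))// fine_ge0.
by rewrite -(fineK Hfin) lee_fin leNgt Hb.
Qed.

End dimension_bound.

Local Open Scope ereal_scope.

Theorem theorem3p22 (R : realType) (d : measure_display)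
  (Omega : measurableType d) (P : probability Omega R)
  (X : {RV P >-> Dstar R}) (hX : unimodular X) :
  udimM_lower X <= udimM_upper X /\ udimM_upper X <= udimH X.
Proof.
split; first exact: limf_einf_le_esup.
exact: udimM_upper_le_udimH.
Qed.
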